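(* Let $H$ be a graph. Then the class of $H$-free graphs is intersectionwise $\chi$-guarding if and only if $H$ is isomorphic to $P_2$, $P_3$, or $rK_1$ for some integer $r>0$.
   Context: All graphs are finite and simple. $P_t$ is the path on $t$ vertices, $rK_1$ the edgeless graph on $r$ vertices; a graph is $H$-free if it has no induced subgraph isomorphic to $H$. The graph-intersection of classes $\mathcal{A},\mathcal{B}$ is the class of all graphs $(V(G)\cap V(H'),E(G)\cap E(H'))$ with $G\in\mathcal{A}$, $H'\in\mathcal{B}$. A class is $\chi$-bounded if there is a non-decreasing $f:\mathbb{N}\to\mathbb{N}$ with $\chi(G)\le f(\omega(G))$ for all members. A class $\mathcal{A}$ is intersectionwise $\chi$-guarding if for every $\chi$-bounded class $\mathcal{B}$ the graph-intersection of $\mathcal{A}$ and $\mathcal{B}$ is $\chi$-bounded.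
   Formalization: In the definition of intersectionwise χ-guarding, the χ-bounded classes B are required to be hereditary (closed under isomorphism and induced subgraphs), since for arbitrary B the claim fails for P_3 and rK_1 with r ≥ 2; H is also assumed to have at least one vertex. *)

(* Defs.v *)
From HB Require Import structures.
From mathcomp Require Import all_boot finmap.

Set Implicit Arguments.
Unset Strict Implicit.
Unset Printing Implicit Defensive.

Local Open Scope fset_scope.

(* Vertices are drawn from the common universe nat, so that vertex sets and
   edge sets of different graphs can be intersected.  An edge is a 2-element
   set of vertices.  The empty graph is allowed. *)
Definition simple_edges (V : {fset nat}) (E : {fset {fset nat}}) : bool :=
  all (fun e : {fset nat} => (e `<=` V) && (#|` e| == 2)) E.

Record graph := Graph {
  vset : {fset nat};
  eset : {fset {fset nat}};
  esetP : simple_edges vset eset }.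

Definition adj (G : graph) (x y : nat) : bool := [fset x; y] \in eset G.

Definition isomorphic (G K : graph) : Prop :=
  exists f : vset G -> vset K,
    bijective f /\
    forall x y : vset G, adj K (val (f x)) (val (f y)) = adj G (val x) (val y).

Lemma induced_subproof (G : graph) (S : {fset nat}) :
  simple_edges (vset G `&` S) [fset e in eset G | e `<=` S].
Proof.
apply/allP => e; rewrite !inE /= => /andP[eG eS].
by have /andP[eV ->] := allP (esetP G) _ eG; rewrite fsubsetI eV eS.
Qed.

Definition induced (G : graph) (S : {fset nat}) : graph :=
  Graph (induced_subproof G S).

Lemma inter_subproof (G K : graph) :
  simple_edges (vset G `&` vset K) (eset G `&` eset K).
Proof.
apply/allP => e; rewrite inE => /andP[eG eK].
have /andP[eVG ->] := allP (esetP G) _ eG.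
by have /andP[eVK _] := allP (esetP K) _ eK; rewrite fsubsetI eVG eVK.
Qed.

Definition graph_inter (G K : graph) : graph := Graph (inter_subproof G K).

Lemma edgeless_subproof (r : nat) : simple_edges [fset i in iota 0 r] fset0.
Proof. by apply/allP => e; rewrite inE. Qed.

Definition edgeless (r : nat) : graph := Graph (edgeless_subproof r).

Lemma path_subproof (t : nat) :
  simple_edges [fset i in iota 0 t] [fset [fset i; i.+1] | i in iota 0 t.-1].
Proof.
apply/allP => e /imfsetP[i /=]; rewrite mem_iota /= add0n => lit ->.
have lt_it : i.+1 < t by case: t lit.
rewrite cardfs2 neq_ltn ltnSn andbT; apply/fsubsetP => j.
rewrite !inE mem_iota /= add0n => /orP[] /eqP-> //.
exact: ltnW.
Qed.

Definition path_graph (t : nat) : graph := Graph (path_subproof t).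

Definition clique (G : graph) (S : {fset nat}) : bool :=
  [forall x : S, [forall y : S, (x != y) ==> adj G (val x) (val y)]].

Definition clique_number (G : graph) : nat :=
  \max_(S <- fpowerset (vset G) | clique G S) #|` S|.

Definition colorable (G : graph) (k : nat) : bool :=
  [exists c : {ffun vset G -> 'I_k},
    [forall x, [forall y, adj G (val x) (val y) ==> (c x != c y)]]].

Lemma colorable_exists (G : graph) : exists k, colorable G k.
Proof.
exists #|{: vset G}|; apply/existsP; exists [ffun x => enum_rank x].
apply/forallP => x; apply/forallP => y; apply/implyP => xy.
rewrite !ffunE (inj_eq enum_rank_inj); apply/eqP => eq_xy.
move: xy; rewrite eq_xy /adj => yy.
by have /andP[_] := allP (esetP G) _ yy; rewrite cardfs2 eqxx.
Qed.

Definition chromatic_number (G : graph) : nat := ex_minn (colorable_exists G).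

Definition graph_class := graph -> Prop.

Definition free (H : graph) : graph_class :=
  fun G => ~ exists S : {fset nat}, isomorphic (induced G S) H.

Definition hereditary (A : graph_class) : Prop :=
  (forall G K, isomorphic G K -> A G -> A K) /\
  (forall G S, A G -> A (induced G S)).

Definition class_inter (A B : graph_class) : graph_class :=
  fun K => exists G H, [/\ A G, B H & K = graph_inter G H].

Definition chi_bounded (A : graph_class) : Prop :=
  exists f : nat -> nat,
    {homo f : m n / m <= n} /\
    forall G, A G -> chromatic_number G <= f (clique_number G).

(* The test classes B are hereditary, as is usual for chi-boundedness.  For
   arbitrary B the notion degenerates: the class B of all disjoint unions of a
   graph G with a complete graph on chromatic_number G vertices satisfies
   chi_bounded B, but intersecting B with complete graphs gives every graph. *)
Definition chi_guarding (A : graph_class) : Prop :=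
  forall B : graph_class,
    hereditary B -> chi_bounded B -> chi_bounded (class_inter A B).

(* Main.v *)
(* A graph with an edge and no induced P_2 + K_1, K_3, K_{1,3} or C_4 is P_2
   or P_3, so it suffices to refute guarding when H contains P_2 + K_1, K_3,
   K_{1,3} or C_4. In each case the shift graph on the arcs (i, j), i < j < n,
   which is triangle-free and needs at least log_2 n colours, is the
   intersection of an H-free graph with a member of a chi-bounded class. For
   K_3, K_{1,3}, C_4 this class consists of the comparability graphs of
   interval orders, and the H-free graph is the shift graph itself, a line
   graph, an interval graph. For P_2 + K_1 the class joins arcs that have a
   common tail or are head to tail (a graph of degeneracy at most twice its
   clique number), and a complete multipartite graph deletes the common-tail
   edges. Conversely, rK_1 is handled by Ramsey's theorem and P_3 component by
   component. *)
Require Import Defs.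
From mathcomp Require Import all_boot finmap zify.

Set Implicit Arguments.
Unset Strict Implicit.
Unset Printing Implicit Defensive.

Local Open Scope fset_scope.

(** * Adjacency, cliques and colourings *)

Lemma fset2_inj (a b c d : nat) : [fset a; b] = [fset c; d] ->
  (a = c /\ b = d) \/ (a = d /\ b = c).
Proof.
move=> /fsetP e; move: (e a) (e b) (e c) (e d); rewrite !inE.
lia.
Qed.

Section Basics.
Variable G : graph.

Lemma adj_sym : symmetric (adj G).
Proof. by move=> x y; rewrite /adj fsetUC. Qed.

Lemma adj_vset x y : adj G x y -> [&& x \in vset G, y \in vset G & x != y].
Proof.
move=> /(allP (esetP G))/andP[/fsubsetP sV].
rewrite cardfs2 eqSS eqb1 => ->.
by rewrite !sV ?inE ?eqxx ?orbT.
Qed.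

Lemma adj_vsetl x y : adj G x y -> x \in vset G.
Proof. by case/adj_vset/and3P. Qed.

Lemma adj_vsetr x y : adj G x y -> y \in vset G.
Proof. by case/adj_vset/and3P. Qed.

Lemma adj_neq x y : adj G x y -> x != y.
Proof. by case/adj_vset/and3P. Qed.

Lemma adj_irr x : adj G x x = false.
Proof. by apply/negP => /adj_neq; rewrite eqxx. Qed.

Lemma adj_induced S x y : adj (induced G S) x y = [&& adj G x y, x \in S & y \in S].
Proof.
rewrite /adj /= !inE /=; case: (_ \in _) => //=.
by apply/fsubsetP/andP => [h | [xS yS] z]; rewrite ?h ?inE ?eqxx ?orbT // => /orP[]/eqP->.
Qed.

Lemma adj_inter K x y : adj (graph_inter G K) x y = adj G x y && adj K x y.
Proof. by rewrite /adj /= inE. Qed.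

Lemma cliqueP (S : {fset nat}) :
  reflect {in S &, forall x y, x != y -> adj G x y} (clique G S).
Proof.
apply: (iffP idP) => [h x y xS yS xy | h].
  by have /forallP/(_ [` xS])/forallP/(_ [` yS])/implyP := h; apply.
by apply/forallP => x; apply/forallP => y; apply/implyP => /h; apply; apply: fsvalP.
Qed.

Lemma clique_number_ge (S : {fset nat}) : S `<=` vset G ->
  {in S &, forall x y, x != y -> adj G x y} -> #|` S| <= clique_number G.
Proof.
move=> SV /cliqueP cS; rewrite /clique_number (big_rem S) /= ?fpowersetE // cS.
exact: leq_maxl.
Qed.

Lemma clique_number_le n :
  (forall S : {fset nat}, S `<=` vset G ->
    {in S &, forall x y, x != y -> adj G x y} -> #|` S| <= n) ->
  clique_number G <= n.
Proof.
move=> h; rewrite /clique_number big_seq_cond.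
apply: (big_ind (fun m => m <= n)) => // [a b an bn | S /andP[]].
  by rewrite geq_max an.
by rewrite fpowersetE => SV /cliqueP; apply: h.
Qed.

(** Colourings become total functions on [nat], so that colourings of different vertex sets can be
    restricted and glued. *)
Lemma colorableP k :
  reflect (exists2 c : nat -> nat, {in vset G, forall x, c x < k} &
             forall x y, adj G x y -> c x != c y) (colorable G k).
Proof.
apply: (iffP existsP) => [[c hc] | [c ck hc]].
  exists (fun x => if insub x is Some u then val (c u) else 0) => [x xV | x y xy].
    by rewrite insubT /=.
  have [xV yV _] := and3P (adj_vset xy).
  rewrite !insubT /=.
  by have /forallP/(_ [` xV])/forallP/(_ [` yV])/implyP := hc; apply.
exists [ffun x => Ordinal (ck _ (fsvalP x))].
apply/forallP => x; apply/forallP => y; apply/implyP => xy.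
by rewrite !ffunE -val_eqE /= hc.
Qed.

Lemma chromatic_number_le k : colorable G k -> chromatic_number G <= k.
Proof. by rewrite /chromatic_number; case: ex_minnP => m _; apply. Qed.

Lemma chromatic_numberP : colorable G (chromatic_number G).
Proof. by rewrite /chromatic_number; case: ex_minnP. Qed.

Lemma colorable_chromatic k : chromatic_number G <= k -> colorable G k.
Proof.
move=> le_k; have /colorableP[c ck hc] := chromatic_numberP.
by apply/colorableP; exists c => // x xV; apply: leq_trans (ck x xV) le_k.
Qed.

End Basics.

(** * Isomorphisms, small paths and edgeless graphs *)

Lemma isomorphicP (G K : graph) :
  isomorphic G K <-> exists f g : nat -> nat,
    [/\ {in vset G, forall x, f x \in vset K}, {in vset K, forall y, g y \in vset G},
        {in vset G, cancel f g}, {in vset K, cancel g f} &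
        {in vset G &, forall x y, adj K (f x) (f y) = adj G x y}].
Proof.
split=> [[f [[g fK gK] fadj]] | [f [g [fV gV fK gK fadj]]]].
  exists (fun x => if insub x is Some u then val (f u) else 0).
  exists (fun x => if insub x is Some u then val (g u) else 0).
  split=> [x xV | y yV | x xV | y yV | x y xV yV]; rewrite !insubT /=.
  - exact: fsvalP.
  - exact: fsvalP.
  - exact: fsvalP.
  - by move=> h; rewrite [Sub _ _](_ : _ = f [` xV]) ?fK //; apply: val_inj.
  - exact: fsvalP.
  - by move=> h; rewrite [Sub _ _](_ : _ = g [` yV]) ?gK //; apply: val_inj.
  - exact: fadj.
exists (fun x => [` fV _ (fsvalP x)]); split; last first.
  by move=> x y; apply: fadj; apply: fsvalP.
by exists (fun x => [` gV _ (fsvalP x)]) => x; apply: val_inj;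
  rewrite /= ?fK ?gK //; apply: fsvalP.
Qed.

Lemma isomorphic_sym G K : isomorphic G K -> isomorphic K G.
Proof.
case/isomorphicP => f [g [fV gV fK gK fadj]]; apply/isomorphicP.
by exists g, f; split=> // x y xV yV; rewrite -fadj ?gK ?gV.
Qed.

Lemma isomorphic_trans G K L : isomorphic G K -> isomorphic K L -> isomorphic G L.
Proof.
case=> f [bf fadj] [f' [bf' f'adj]]; exists (f' \o f); split; first exact: bij_comp.
by move=> x y /=; rewrite f'adj fadj.
Qed.

Lemma free_isomorphic H H' G : isomorphic H H' -> free H G -> free H' G.
Proof.
move=> HH' fG [S GS]; apply: fG; exists S.
exact: isomorphic_trans GS (isomorphic_sym HH').
Qed.

Lemma adj_path t x y :
  adj (path_graph t) x y = (x.+1 == y) && (y < t) || (y.+1 == x) && (x < t).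
Proof.
apply/imfsetP/idP => [[i /=] | ].
  by rewrite mem_iota => it /fset2_inj [] [-> ->]; lia.
case/orP => /andP[/eqP <- lt].
  by exists x; rewrite // mem_iota /=; lia.
by exists y; rewrite 1?fsetUC // mem_iota /=; lia.
Qed.

Lemma adj_edgeless r x y : adj (edgeless r) x y = false.
Proof. by rewrite /adj /= inE. Qed.

Lemma vset_path t x : (x \in vset (path_graph t)) = (x < t).
Proof. by rewrite !inE /= mem_iota. Qed.

Lemma vset_edgeless t x : (x \in vset (edgeless t)) = (x < t).
Proof. by rewrite !inE /= mem_iota. Qed.

Lemma isomorphic_edgeless (G : graph) :
  (forall x y, ~~ adj G x y) -> isomorphic G (edgeless #|` vset G|).
Proof.
move=> e0; apply/isomorphicP.
exists (index^~ (vset G)), (nth 0 (vset G)); split.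
- by move=> x xV; rewrite vset_edgeless index_mem.
- by move=> y; rewrite vset_edgeless; apply: mem_nth.
- by move=> x xV; rewrite nth_index.
- by move=> y; rewrite vset_edgeless => yV; rewrite index_uniq ?fset_uniq.
- by move=> x y _ _; rewrite adj_edgeless (negPf (e0 _ _)).
Qed.

Lemma isomorphic_path2 (G : graph) a b :
  adj G a b -> vset G = [fset a; b] -> isomorphic G (path_graph 2).
Proof.
move=> ab VG; have nab := adj_neq ab; apply/isomorphicP.
exists (fun x => (x == b) : nat), (fun i => if i == 0 then a else b).
have abF := negPf nab; have baF : b == a = false by rewrite eq_sym.
split=> [x | i | x | i | x y]; rewrite ?vset_path ?VG ?inE.
- by move=> _; case: (x == b).
- by case: (i == 0); rewrite eqxx ?orbT.
- by case/orP => /eqP ->; rewrite ?abF ?eqxx.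
- by case: i => [|[|i]] //= _; rewrite ?abF ?eqxx.
- by case/orP => /eqP ->; case/orP => /eqP ->;
    rewrite adj_path ?abF ?eqxx ?adj_irr // ?(adj_sym _ b) ab.
Qed.

Lemma isomorphic_path3 (G : graph) a b c :
  adj G a b -> adj G b c -> ~~ adj G a c -> a != c ->
  vset G = [fset a; b; c] -> isomorphic G (path_graph 3).
Proof.
move=> ab bc ac nac VG.
have abF := negPf (adj_neq ab); have bcF := negPf (adj_neq bc).
have acF := negPf nac; have caF : c == a = false by rewrite eq_sym.
have baF : b == a = false by rewrite eq_sym.
have cbF : c == b = false by rewrite eq_sym.
have E := (abF, bcF, acF, caF, baF, cbF, eqxx).
have ba : adj G b a by rewrite adj_sym.
have cb : adj G c b by rewrite adj_sym.
have ca : adj G c a = false by rewrite adj_sym (negPf ac).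
apply/isomorphicP.
exists (fun x => if x == a then 0 else if x == b then 1 else 2).
exists (fun i => if i is j.+1 then if j is 0 then b else c else a).
split=> [x | i | x | i | x y]; rewrite ?vset_path ?VG ?inE.
- by case: eqP => //; case: eqP.
- by case: i => [|[|i]] _; rewrite ?E ?orbT.
- by rewrite -orbA => /or3P[] /eqP ->; rewrite ?E.
- by case: i => [|[|[|i]]] //= _; rewrite ?E.
- by rewrite -!orbA => /or3P[] /eqP ->; case/or3P => /eqP ->;
    rewrite !E adj_path ?ab ?bc ?ba ?cb ?ca ?(negPf ac) ?adj_irr.
Qed.

(** * Graphs defined by a relation, and graphs on arcs *)

Section SymmetricGraph.
Variables (V : {fset nat}) (r : rel nat).

Lemma graph_on_subproof :
  simple_edges V [fset [fset p.1; p.2] |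
    p in [seq p <- [seq (x, y) | x <- V, y <- V] | (p.1 != p.2) && r p.1 p.2]].
Proof.
apply/allP => e /imfsetP[p /=]; rewrite mem_filter => /andP[/andP[np _]].
case/allpairsP => q [q1 q2 pq] ->; rewrite cardfs2 np andbT.
by apply/fsubsetP => z; rewrite !inE pq => /orP[]/eqP->.
Qed.

Definition graph_on := Graph graph_on_subproof.

Lemma adj_graph_on x y :
  adj graph_on x y = [&& x \in V, y \in V, x != y & r x y || r y x].
Proof.
apply/imfsetP/and4P => [[[a b] /=] | [xV yV xy rxy]].
  rewrite mem_filter => /andP[/= /andP[nab rab] /allpairsP[[u v] /= [uV vV [au bv]]]].
  rewrite -au in uV; rewrite -bv in vV.
  case/fset2_inj => [] [-> ->]; first by rewrite rab.
  by rewrite rab orbT eq_sym.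
have pairV (p q : nat) : p \in V -> q \in V -> (p, q) \in [seq (x, y) | x <- V, y <- V].
  by move=> pV qV; apply/allpairsP; exists (p, q).
case/orP: rxy => rxy.
  by exists (x, y); rewrite //= mem_filter /= xy rxy pairV.
exists (y, x); last by rewrite /= fsetUC.
by rewrite mem_filter /= eq_sym xy rxy pairV.
Qed.

End SymmetricGraph.

(* The vertex [x] stands for the arc from [(arc x).1] to [(arc x).2]. *)
Definition arc_code : nat * nat -> nat := choice.pickle.

Definition arc (x : nat) : nat * nat := odflt (0, 0) (choice.unpickle x).

Lemma arc_codeK : cancel arc_code arc.
Proof. by move=> p; rewrite /arc /arc_code choice.pickleK. Qed.

Definition arcs (n : nat) : {fset nat} :=
  [fset x in [seq arc_code p | p <- [seq (i, j) | i <- iota 0 n, j <- iota 0 n]]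
     | (arc x).1 < (arc x).2].

Lemma arcs_lt n x : x \in arcs n -> (arc x).1 < (arc x).2.
Proof. by rewrite !inE => /andP[]. Qed.

Lemma arc_code_arcs n i j : i < j -> j < n -> arc_code (i, j) \in arcs n.
Proof.
move=> ij jn; rewrite !inE /= arc_codeK ij andbT map_f //.
by apply/allpairsP; exists (i, j); rewrite !mem_iota /= jn (ltn_trans ij).
Qed.

Definition arc_graph (n : nat) (r : rel (nat * nat)) : graph :=
  graph_on (arcs n) (relpre arc r).

(** The labelling [l] replaces the fixed decoding [arc], which makes the class closed under
    isomorphism. Labels may repeat, and their endpoints are unbounded. *)
Definition arc_class (r : rel (nat * nat)) : graph_class := fun K =>
  exists l : nat -> nat * nat, {in vset K, forall x, (l x).1 < (l x).2} /\
    {in vset K &, forall x y, adj K x y = (x != y) && (r (l x) (l y) || r (l y) (l x))}.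

Lemma arc_class_hereditary r : hereditary (arc_class r).
Proof.
split=> [G K /isomorphicP[f [g [fV gV fK gK fadj]]] [l [lt_l adjl]] | G S [l [lt_l adjl]]].
  exists (l \o g); split=> [x xV | x y xV yV] /=; first by rewrite lt_l ?gV.
  rewrite -{1}(gK x) // -{1}(gK y) // fadj ?gV // adjl ?gV //.
  by rewrite (inj_in_eq (can_in_inj gK)).
exists l; split=> [x | x y]; rewrite !inE => /andP[xV xS]; first exact: lt_l.
by case/andP => yV yS; rewrite adj_induced xS yS !andbT adjl.
Qed.

Lemma arc_class_graph n r : arc_class r (arc_graph n r).
Proof.
exists arc; split=> [x /arcs_lt // | x y xV yV].
by rewrite adj_graph_on xV yV.
Qed.

(** * The shift graph: adjacency is [touch], symmetrised *)

Definition touch (p q : nat * nat) : bool := p.2 == q.1.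

Section Shift.
Variables (n : nat) (X : graph).
Hypothesis vsetX : vset X = arcs n.
Hypothesis adjX : {in arcs n &, forall x y,
  adj X x y = touch (arc x) (arc y) || touch (arc y) (arc x)}.

(* The sets of colours of the arcs leaving the vertices i < n are pairwise
   distinct: the colour of (i, j) is not used by any arc (j, k). *)
Lemma shift_colorable k : colorable X k -> n <= 2 ^ k.
Proof.
case/colorableP => c ck hc.
pose C (i : 'I_n) := [set a : 'I_k | [exists j : 'I_n,
  (i < j) && (c (arc_code (nat_of_ord i, nat_of_ord j)) == a)]].
have C_neq (i j : 'I_n) : i < j -> C i <> C j.
  move=> ij /setP eqC; pose x := arc_code (nat_of_ord i, nat_of_ord j).
  have xX : x \in arcs n by apply: arc_code_arcs.
  have cx : c x < k by rewrite ck ?vsetX.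
  have /existsP[m /andP[jm /eqP cjm]] : [exists m : 'I_n, (j < m) &&
      (c (arc_code (nat_of_ord j, nat_of_ord m)) == Ordinal cx)].
    have := eqC (Ordinal cx); rewrite !inE => <-.
    by apply/existsP; exists j; apply/andP; split; last exact: eqxx.
  have yX := arc_code_arcs jm (ltn_ord m).
  suff /hc/eqP[] : adj X x (arc_code (nat_of_ord j, nat_of_ord m)) by rewrite cjm.
  by rewrite adjX // !arc_codeK /touch /= eqxx.
have C_inj : injective C.
  move=> i j eqC; case: (ltngtP i j) => [/C_neq | /C_neq | /ord_inj] //.
  by rewrite eqC.
have := leq_card C C_inj.
by rewrite card_ord -[X in _ <= X]cardsT -powersetT card_powerset cardsT card_ord.
Qed.

(** Each touch raises the tail, so three pairwise touching arcs could be ordered as p, q, s with p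
    touching q and s, and q touching s. Then q and s share their tail, yet q ends at the tail of
    s. *)
Lemma shift_clique_number : clique_number X <= 2.
Proof.
apply: clique_number_le => S; rewrite vsetX => /fsubsetP SV cS.
rewrite leqNgt cardfE; apply/negP.
case/card_gt2P => x [y [z [_ [xy yz zx]]]].
have Ax := SV _ (fsvalP x); have Ay := SV _ (fsvalP y); have Az := SV _ (fsvalP z).
move: (cS _ _ (fsvalP x) (fsvalP y) xy) (cS _ _ (fsvalP y) (fsvalP z) yz)
  (cS _ _ (fsvalP z) (fsvalP x) zx).
rewrite !adjX // /touch; move: (arcs_lt Ax) (arcs_lt Ay) (arcs_lt Az).
lia.
Qed.

End Shift.

(** * Two chi-bounded classes of arc graphs *)

Definition before (p q : nat * nat) : bool := p.2 <= q.1.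

Definition fork (p q : nat * nat) : bool := (p.1 == q.1) || touch p q.

(** An interval x is coloured by the largest clique among the intervals ending no later than x. If x
    is before y, all of these are before y, so y enlarges any clique of them and gets a larger
    colour. Colours go from 0 up to the clique number, whence [succn]. *)
Lemma chi_bounded_before : chi_bounded (arc_class before).
Proof.
exists succn; split=> // K [l [lt_l adjl]]; apply: chromatic_number_le.
pose D x := induced K [fset y in vset K | (l y).2 <= (l x).2].
have D_lt x y : x \in vset K -> y \in vset K -> before (l x) (l y) ->
    clique_number (D x) < clique_number (D y).
  move=> xV yV; rewrite /before => xy; have lty := lt_l y yV.
  have sub S : S `<=` vset (D x) ->
      {in S &, forall u v, u != v -> adj (D x) u v} -> #|` S| < clique_number (D y).
    move=> /fsubsetP SD cS.
    have inS u : u \in S -> (u \in vset K) /\ ((l u).2 <= (l x).2).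
      by move/SD; rewrite !inE /= => /and3P[].
    have yS : y \notin S by apply/negP => /inS[_]; lia.
    have -> : #|` S|.+1 = #|` y |` S| by rewrite cardfsU1 yS.
    have adjy u : u \in S -> adj (D y) y u && adj (D y) u y.
      move=> uS; have [uV ux] := inS u uS.
      have uy : u != y by apply: contraNneq yS => <-.
      rewrite [adj _ y u]adj_sym andbb adj_induced adjl // uy /before !inE /=.
      by rewrite uV yV; lia.
    apply: clique_number_ge.
      apply/fsubsetP => u; rewrite !inE /= => /predU1P[-> | /inS[-> ux]] /=.
        by rewrite yV leqnn.
      by lia.
    move=> u v /fset1UP[-> | uS] /fset1UP[-> | vS] uv.
    - by rewrite eqxx in uv.
    - by case/andP: (adjy v vS).
    - by case/andP: (adjy u uS).
    - have := cS u v uS vS uv; rewrite !adj_induced => /andP[-> _].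
      have [uV ux] := inS u uS; have [vV vx] := inS v vS.
      by rewrite !inE /= uV vV; lia.
  (* [clique_number_le] only gives non-strict bounds, so it is applied to the predecessor; the empty
     clique shows that the predecessor exists. *)
  have pos : 0 < clique_number (D y).
    by apply: leq_ltn_trans (sub fset0 _ _) => // u v; rewrite inE.
  rewrite -(ltn_predK pos) ltnS; apply: clique_number_le => S SD cS.
  by rewrite -ltnS (ltn_predK pos); apply: sub.
apply/colorableP; exists (fun x => clique_number (D x)) => [x xV | x y xy].
  rewrite ltnS; apply: clique_number_le => S /fsubsetP SD cS.
  apply: clique_number_ge; first by apply/fsubsetP => u /SD; rewrite inE => /andP[].
  by move=> u v uS vS uv; have := cS u v uS vS uv; rewrite adj_induced => /andP[].
have [xV yV nxy] := and3P (adj_vset xy).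
move: xy; rewrite adjl // nxy neq_ltn => /orP[] /D_lt -> //.
by rewrite orbT.
Qed.

(** Greedy colouring: remove a vertex with at most [d] neighbours in the current set and colour the
    rest; one of the [d.+1] colours is then free for it. *)
Lemma degenerate_colorable G d :
  (forall S : {fset nat}, S `<=` vset G -> S != fset0 ->
     exists2 x, x \in S & #|` [fset y in S | adj G x y]| <= d) ->
  colorable G d.+1.
Proof.
move=> degG.
suff /(_ _ _ (ltnSn _) (fsubset_refl _)) [c ck hc] :
    forall m (S : {fset nat}), #|` S| < m -> S `<=` vset G ->
    exists2 c : nat -> nat, {in S, forall x, c x < d.+1} &
      {in S &, forall x y, adj G x y -> c x != c y}.
  apply/colorableP; exists c => // x y xy.
  by have [xV yV _] := and3P (adj_vset xy); apply: hc.
elim=> // m IH S Sm SV.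
have [-> | S0] := eqVneq S fset0.
  by exists (fun=> 0) => [x | x y]; rewrite inE.
have [x xS Nx] := degG S SV S0.
have [|| c ck hc] := IH (S `\ x).
- by move: Sm; rewrite (cardfsD1 x) xS.
- by apply: fsubset_trans (fsubD1set _ _) SV.
have [a ad aN] : exists2 a, a < d.+1 & a \notin [seq c y | y <- [fset y in S | adj G x y]].
  have [/allP h | /allPn[a]] :=
    boolP (all (mem [seq c y | y <- [fset y in S | adj G x y]]) (iota 0 d.+1)).
    have := uniq_leq_size (iota_uniq 0 d.+1) h.
    by rewrite size_iota size_map leqNgt ltnS Nx.
  by rewrite mem_iota => ad; exists a.
exists (fun y => if y == x then a else c y) => [y yS | y z yS zS yz].
  by case: eqVneq => // yx; apply: ck; rewrite !inE yx.
have aP u : u \in S -> adj G x u -> a != c u.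
  by move=> uS xu; apply: contraNneq aN => ->; apply/map_f; rewrite !inE uS.
case: (eqVneq y x) yz => [-> | yx]; case: (eqVneq z x) => [-> | zx] yz.
- by rewrite adj_irr in yz.
- exact: aP.
- by rewrite eq_sym aP // adj_sym.
- by apply: hc; rewrite ?inE ?yx ?zx.
Qed.

(** Arcs with a common tail form a clique. Given an arc of least tail in a set, its neighbours there
    start at its tail or at its head, because an arc ending at its tail would start earlier. Two
    cliques thus contain them all, and greedy colouring adds one colour. *)
Lemma chi_bounded_fork : chi_bounded (arc_class fork).
Proof.
exists (fun m => (m + m).+1); split=> [m n mn | K [l [lt_l adjl]]]; first by lia.
apply/chromatic_number_le/degenerate_colorable => S /fsubsetP SV /fset0Pn[x0 x0S].
have [[x xS] _ /= minx] := arg_minnP (fun u : S => (l (val u)).1) (isT : xpredT [` x0S]).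
exists x => //.
pose T i := [fset y in vset K | (l y).1 == i].
have cT i : #|` T i| <= clique_number K.
  apply: clique_number_ge; first by apply/fsubsetP => y; rewrite !inE => /andP[].
  move=> y z; rewrite !inE => /andP[yV /eqP yi] /andP[zV /eqP zi] yz.
  by rewrite adjl // yz /fork yi zi eqxx.
apply: leq_trans (leq_add (cT (l x).1) (cT (l x).2)).
apply: leq_trans (_ : #|` T (l x).1 `|` T (l x).2| <= _); last first.
  by rewrite cardfsU leq_subr.
apply/fsubset_leq_card/fsubsetP => y; rewrite !inE => /andP[yS].
have [xV yV] := (SV x xS, SV y yS).
rewrite yV adjl // /fork /touch => /andP[_].
have := minx [` yS] isT; have := lt_l y yV; rewrite /=; lia.
Qed.

(** * Refuting guarding by writing the shift graph as an intersection *)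

Lemma not_chi_guarding (A : graph_class) (rG r : rel (nat * nat)) :
  (forall n, A (arc_graph n rG)) -> chi_bounded (arc_class r) ->
  (forall p q, p.1 < p.2 -> q.1 < q.2 ->
     (rG p q || rG q p) && (r p q || r q p) = touch p q || touch q p) ->
  ~ chi_guarding A.
Proof.
move=> AG chi_r rGr /(_ _ (arc_class_hereditary r) chi_r)[f [f_mono hf]].
(* The shift graph has clique number at most 2, so it would be coloured with [f 2] colours; [n] is
   the first value exceeding the bound of [shift_colorable]. *)
pose n := (2 ^ f 2).+1; pose X := graph_inter (arc_graph n rG) (arc_graph n r).
have vX : vset X = arcs n by rewrite /= fsetIid.
have adjX : {in arcs n &, forall x y,
    adj X x y = touch (arc x) (arc y) || touch (arc y) (arc x)}.
  move=> x y xV yV; have [ltx lty] := (arcs_lt xV, arcs_lt yV).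
  rewrite adj_inter !adj_graph_on xV yV /= -rGr //.
  case: eqVneq => //= ->; rewrite rGr // /touch orbb.
  by apply/esym/negbTE; lia.
have XP : class_inter A (arc_class r) X.
  by exists (arc_graph n rG), (arc_graph n r); split=> //; apply: arc_class_graph.
have := hf X XP; have := f_mono _ _ (shift_clique_number vX adjX).
move=> h1 h2; have := shift_colorable vX adjX (colorable_chromatic (leq_trans h2 h1)).
by rewrite ltnn.
Qed.

(** An induced copy of [H] in an arc graph labels the vertices of [H] by arcs. Freeness for every n
    thus reduces to the absence of such a labelling, which is arithmetic on a few endpoints when [H]
    contains a given small graph. *)
Lemma not_chi_guarding_free (H : graph) (rG r : rel (nat * nat)) :
  (forall l : nat -> nat * nat, {in vset H, forall x, (l x).1 < (l x).2} ->
     ~ {in vset H &, forall x y, x != y -> adj H x y = rG (l x) (l y) || rG (l y) (l x)}) ->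
  chi_bounded (arc_class r) ->
  (forall p q, p.1 < p.2 -> q.1 < q.2 ->
     (rG p q || rG q p) && (r p q || r q p) = touch p q || touch q p) ->
  ~ chi_guarding (free H).
Proof.
move=> noH; apply: not_chi_guarding => n [S].
case/isomorphicP=> f [g [fV gV fK gK fadj]].
have gA x : x \in vset H -> g x \in arcs n by move/gV; rewrite inE => /andP[].
have gS x : x \in vset H -> g x \in S by move/gV; rewrite inE => /andP[].
apply: (noH (arc \o g)) => [x /gA/arcs_lt // | x y xV yV xy].
rewrite -{1}(gK x) // -{1}(gK y) // fadj ?gV // adj_induced !gS // !andbT.
have gxy : g x != g y by apply: contraNneq xy => /(can_in_inj gK) ->.
by rewrite adj_graph_on !gA //= gxy.
Qed.

(** * The four obstructions and the shape of [H] *)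

Section Guarding.
Variable H : graph.
Hypothesis guardH : chi_guarding (free H).

(** The shift graph is itself triangle-free, and touching arcs are comparable in the interval order,
    so intersecting with [before] deletes nothing. *)
Lemma guarding_triangle a b c : adj H a b -> adj H b c -> ~~ adj H a c.
Proof.
move=> ab bc; apply/negP => ac.
have [aV bV nab] := and3P (adj_vset ab); have [_ cV nbc] := and3P (adj_vset bc).
have nac := adj_neq ac.
apply: (not_chi_guarding_free _ chi_bounded_before _ guardH (rG := touch)) => [l lt_l adjl | p q].
  move: (lt_l a aV) (lt_l b bV) (lt_l c cV) ab bc ac; rewrite !adjl // /touch.
  by lia.
by rewrite /touch /before; lia.
Qed.

(* Pairwise touching arcs are intersecting closed intervals with disjoint
   interiors, and interval graphs have no induced four-cycle. *)
Lemma guarding_square a b c d :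
  adj H a b -> adj H b c -> adj H c d -> adj H d a -> a != c -> b != d ->
  adj H a c || adj H b d.
Proof.
move=> ab bc cd da nac nbd; apply/negPn/negP; rewrite negb_or => /andP[ac bd].
have [aV bV nab] := and3P (adj_vset ab); have [_ cV nbc] := and3P (adj_vset bc).
have [_ dV ncd] := and3P (adj_vset cd); have nda := adj_neq da.
pose overlap (p q : nat * nat) := (p.1 <= q.2) && (q.1 <= p.2).
apply: (not_chi_guarding_free _ chi_bounded_before _ guardH (rG := overlap)) => [l lt_l adjl | p q].
  move: (lt_l a aV) (lt_l b bV) (lt_l c cV) (lt_l d dV)
    ab bc cd da ac bd; rewrite !adjl // /overlap.
  by lia.
by rewrite /overlap /touch /before; lia.
Qed.

(* Sharing an endpoint is adjacency in a line graph, which is claw-free. *)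
Lemma guarding_claw a b c d :
  adj H a b -> adj H a c -> adj H a d -> b != c -> b != d -> c != d ->
  [|| adj H b c, adj H b d | adj H c d].
Proof.
pose on (i : nat) (p : nat * nat) := (p.1 == i) || (p.2 == i).
pose meet (p q : nat * nat) := on p.1 q || on p.2 q.
have meetP i p q : on i p -> on i q -> meet p q.
  by rewrite /meet /on; case/orP=> /eqP-> ->; rewrite ?orbT.
have meet_touch p q : p.1 < p.2 -> q.1 < q.2 ->
  (meet p q || meet q p) && (before p q || before q p) = touch p q || touch q p.
  by rewrite /meet /on /touch /before; lia.
have meetC p q : meet p q || meet q p = meet p q.
  have -> : meet q p = meet p q by rewrite /meet /on orbACA !(eq_sym q.1) !(eq_sym q.2).
  exact: orbb.
move=> ab ac ad nbc nbd ncd; apply/negPn/negP.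
rewrite !negb_or => /and3P[bc bd cd].
have [aV bV nab] := and3P (adj_vset ab); have [_ cV nac] := and3P (adj_vset ac).
have [_ dV nad] := and3P (adj_vset ad).
apply: (not_chi_guarding_free _ chi_bounded_before meet_touch guardH) => l lt_l adjl.
move: ab ac ad bc bd cd; rewrite !adjl // !meetC => ab ac ad bc bd cd.
(* Each of the three arcs contains one of the two endpoints of [l a], so two of them share one. *)
case/orP: ab => bi; case/orP: ac => ci; case/orP: ad => di.
all: by [case/negP: bc; apply: meetP bi ci | case/negP: bd; apply: meetP bi di
        | case/negP: cd; apply: meetP ci di].
Qed.

(* Grouping the arcs by tail gives a complete multipartite graph. *)
Lemma guarding_edge_vertex a b c :
  adj H a b -> c \in vset H -> c != a -> c != b -> adj H a c || adj H b c.
Proof.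
move=> ab cV nca ncb; apply/negPn/negP; rewrite negb_or => /andP[ac bc].
have [aV bV nab] := and3P (adj_vset ab).
pose apart (p q : nat * nat) := p.1 != q.1.
apply: (not_chi_guarding_free _ chi_bounded_fork _ guardH (rG := apart)) => [l lt_l adjl | p q].
  move: ab ac bc; rewrite !adjl // 1?eq_sym // /apart.
  by lia.
by rewrite /apart /fork /touch; lia.
Qed.

(** If a fourth vertex d is adjacent to b, a triangle or a claw arises. Otherwise the edges ab and
    bc force d to be adjacent to a and to c, which closes an induced four-cycle. *)
Lemma guarding_path a b c d : adj H a b -> adj H b c -> a != c ->
  d \in vset H -> [|| d == a, d == b | d == c].
Proof.
move=> ab bc nac dV; apply/negPn/negP; rewrite !negb_or => /and3P[nda ndb ndc].
have ac := guarding_triangle ab bc.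
have ba : adj H b a by rewrite adj_sym.
have [bd | nbd] := boolP (adj H b d).
  have ad := guarding_triangle ab bd.
  have cd : ~~ adj H c d by apply: guarding_triangle bd; rewrite adj_sym.
  have := guarding_claw ba bc bd nac; rewrite (negPf ac) (negPf ad) (negPf cd).
  by rewrite ![_ == d]eq_sym nda ndc => /(_ isT isT).
have := guarding_edge_vertex ab dV nda ndb; rewrite (negPf nbd) orbF => ad.
have := guarding_edge_vertex bc dV ndb ndc; rewrite (negPf nbd) /= => cd.
have := guarding_square ab bc cd; rewrite adj_sym ad (negPf ac) (negPf nbd) nac eq_sym ndb.
by move/(_ isT isT isT).
Qed.

(** Given an edge ab, a third vertex is adjacent to a or b; this yields a path on three vertices,
    which exhausts [H] by [guarding_path]. *)
Lemma guarding_isomorphic : vset H <> fset0 ->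
  isomorphic H (path_graph 2) \/ isomorphic H (path_graph 3) \/
  exists r : nat, 0 < r /\ isomorphic H (edgeless r).
Proof.
move=> H0.
have [/existsP[a /existsP[b ab]] | noE] :=
  boolP [exists a : vset H, [exists b : vset H, adj H (val a) (val b)]]; last first.
  right; right; exists #|` vset H|; split; first by rewrite cardfs_gt0; apply/eqP.
  apply: isomorphic_edgeless => x y; apply: contra noE => xy.
  have [xV yV _] := and3P (adj_vset xy).
  by apply/existsP; exists [` xV]; apply/existsP; exists [` yV].
move: (val a) (val b) ab => {}a {}b ab.
have [aV bV nab] := and3P (adj_vset ab).
have P3 u m w : adj H u m -> adj H m w -> u != w -> isomorphic H (path_graph 3).
  move=> um mw uw; apply: (isomorphic_path3 um mw (guarding_triangle um mw) uw).
  apply/fsetP => z; rewrite !inE -orbA; apply/idP/idP; first exact: guarding_path.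
  by case/or3P => /eqP ->; [apply: adj_vsetl um | apply: adj_vsetr um | apply: adj_vsetr mw].
have [VE | [c]] := fset_0Vmem (vset H `\` [fset a; b]).
  left; apply: (isomorphic_path2 ab); apply/eqP; rewrite eqEfsubset -fsetD_eq0 VE eqxx /=.
  by apply/fsubsetP => z; rewrite !inE => /orP[]/eqP->.
rewrite !inE negb_or => /andP[/andP[nca ncb] cV]; right; left.
have /orP[ac | bc] := guarding_edge_vertex ab cV nca ncb.
  by apply: (P3 b a c) => //; rewrite 1?adj_sym // eq_sym.
by apply: (P3 a b c) => //; rewrite eq_sym.
Qed.

End Guarding.

(** * The guarding classes *)

Lemma chi_guarding_path2 : chi_guarding (free (path_graph 2)).
Proof.
move=> B _ _; exists (fun=> 1); split=> // _ [G [K [GF _ ->]]].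
apply: chromatic_number_le; apply/colorableP; exists (fun=> 0) => // x y.
rewrite adj_inter => /andP[xy _]; case: GF; exists [fset x; y].
have [xV yV _] := and3P (adj_vset xy).
apply: (@isomorphic_path2 _ x y); first by rewrite adj_induced xy !inE !eqxx orbT.
apply/fsetP => z; rewrite !inE andb_idl // => /orP[] /eqP->.
  exact: xV.
exact: yV.
Qed.

Lemma free_path3_trans G x y z : free (path_graph 3) G ->
  adj G x y -> adj G y z -> x != z -> adj G x z.
Proof.
move=> GF xy yz nxz; apply/negPn/negP => xz; apply: GF; exists [fset x; y; z].
have [xV yV _] := and3P (adj_vset xy); have zV := adj_vsetr yz.
apply: (@isomorphic_path3 _ x y z) => //.
- by rewrite adj_induced xy !inE !eqxx !orbT.
- by rewrite adj_induced yz !inE !eqxx !orbT.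
- by rewrite adj_induced (negPf xz).
apply/fsetP => u; rewrite !inE andb_idl // -orbA => /or3P[] /eqP->.
- exact: xV.
- exact: yV.
- exact: zV.
Qed.

(* The components of a P_3-free graph are cliques, hence each of them meets
   K in an induced subgraph of K; these are coloured independently. *)
Lemma chi_guarding_path3 : chi_guarding (free (path_graph 3)).
Proof.
move=> B [_ B_ind] [f [f_mono hf]]; exists f; split=> // _ [G [K [GF KB ->]]].
set X := graph_inter G K; apply: chromatic_number_le.
suff /(_ _ _ (ltnSn _) (fsubset_refl _)) [c ck hc] :
    forall m (S : {fset nat}), #|` S| < m -> S `<=` vset X ->
    exists2 c : nat -> nat, {in S, forall x, c x < f (clique_number X)} &
      {in S &, forall x y, adj X x y -> c x != c y}.
  apply/colorableP; exists c => // x y xy.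
  by have [xV yV _] := and3P (adj_vset xy); apply: hc.
elim=> // m IH S Sm SV.
have [-> | [x xS]] := fset_0Vmem S.
  by exists (fun=> 0) => [x | x y]; rewrite inE.
(* By transitivity this closed neighbourhood is the component of [x] in the restriction of [G] to
   [S]. *)
pose C := [fset y in S | (y == x) || adj G x y].
have xC : x \in C by rewrite !inE xS eqxx.
have C_clique : {in C &, forall u v, u != v -> adj G u v}.
  move=> u v; rewrite !inE => /andP[_ ux] /andP[_ vx] uv.
  case/predU1P: ux uv => [-> | xu]; case/predU1P: vx => [-> | xv] uv.
  - by rewrite eqxx in uv.
  - exact: xv.
  - by rewrite adj_sym.
  - by apply: (free_path3_trans GF) xv uv; rewrite adj_sym.
have C_closed u v : u \in C -> v \in S -> adj G u v -> v \in C.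
  rewrite !inE => /andP[_ ux] vS uv; rewrite vS /=.
  case: eqVneq => //= vx; case/predU1P: ux uv => [-> // | xu uv].
  by apply: (free_path3_trans GF) xu uv _; rewrite eq_sym.
have [||c1 c1k hc1] := IH (S `\` C).
- rewrite ltnS in Sm; apply: leq_trans Sm; apply: fproper_ltn_card.
  by rewrite fproperE fsubsetDl; apply/fsubsetPn; exists x; rewrite // inE xC.
- exact: fsubset_trans (fsubsetDl _ _) SV.
(* Since [C] is a clique of [G], cliques of [induced K C] are cliques of [X]. The same palette
   serves every component. *)
have /colorableP[c2 c2k hc2] : colorable (induced K C) (f (clique_number X)).
  apply: colorable_chromatic; apply: leq_trans (hf _ (B_ind _ C KB)) _.
  apply: f_mono; apply: clique_number_le => T /fsubsetP TC cT.
  have TS u : u \in T -> u \in C by move/TC; rewrite inE => /andP[].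
  apply: clique_number_ge => [|u v uT vT uv].
    by apply/fsubsetP => u /TS; rewrite inE => /andP[/(fsubsetP SV)].
  rewrite adj_inter C_clique ?TS //=.
  by have := cT u v uT vT uv; rewrite adj_induced => /andP[].
exists (fun u => if u \in C then c2 u else c1 u) => [u uS | u v uS vS].
  case: ifPn => uC; last by apply: c1k; rewrite inE uC.
  by apply: c2k; rewrite inE uC andbT; have := fsubsetP SV u uS; rewrite inE => /andP[].
rewrite adj_inter => /andP[uvG uvK].
case: ifPn => uC; last first.
  have vC : v \notin C.
    by apply: contra uC => vC; apply: (C_closed v u vC uS); rewrite adj_sym.
  by rewrite (negPf vC); apply: hc1; rewrite ?in_fsetD ?uC ?vC // adj_inter uvG.
have vC := C_closed u v uC vS uvG.
by rewrite vC; apply: hc2; rewrite adj_induced uvK uC.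
Qed.

(** Induction on [r + k]: a vertex x splits the others into neighbours and non-neighbours. In the
    first part x extends a clique, in the second an independent set. *)
Lemma ramsey (e : rel nat) r k (S : {fset nat}) : symmetric e -> 2 ^ (r + k) <= #|` S| ->
  (exists T : {fset nat}, [/\ T `<=` S, #|` T| = r & {in T &, forall x y, x != y -> ~~ e x y}]) \/
  (exists T : {fset nat}, [/\ T `<=` S, #|` T| = k & {in T &, forall x y, x != y -> e x y}]).
Proof.
move=> e_sym; move: {2}(r + k)%N (erefl (r + k)%N) => m.
elim: m r k S => [|m IH] [|r] [|k] S //= rk.
all: try by [left; exists fset0; split; rewrite ?fsub0set ?cardfs0 // => x; rewrite inE].
all: try by [right; exists fset0; split; rewrite ?fsub0set ?cardfs0 // => x; rewrite inE].
have extend b (T : {fset nat}) x : x \notin T -> {in T, forall y, e x y = b} ->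
    {in T &, forall y z, y != z -> e y z = b} ->
    {in x |` T &, forall y z, y != z -> e y z = b}.
  move=> xT xb Tb y z /fset1UP[-> | yT] /fset1UP[-> | zT] yz.
  - by rewrite eqxx in yz.
  - exact: xb.
  - by rewrite e_sym xb.
  - exact: Tb.
have [-> | [x xS]] := fset_0Vmem S; first by rewrite cardfs0 leqNgt expn_gt0.
pose N b := [fset y in S `\ x | e x y == b].
have NS b : x |` N b `<=` S.
  by apply/fsubsetP => y /fset1UP[-> // |]; rewrite !inE => /andP[/andP[]].
have xN b : x \notin N b by rewrite !inE eqxx.
have eN b y : y \in N b -> e x y = b by rewrite !inE => /andP[_ /eqP].
have cardS : (#|` S| = (#|` N true| + #|` N false|).+1)%N.
  rewrite (cardfsD1 x) xS add1n; congr _.+1.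
  rewrite -(cardfsID (N true) (S `\ x)); congr (_ + _)%N; congr (#|` _|).
    by apply/fsetP => y; rewrite !inE andb_idl // => /andP[].
  by apply/fsetP => y; rewrite !inE; case: (e x y); rewrite /= ?andbT ?andbF ?andNb.
rewrite rk expnS mul2n -addnn cardS => le_m.
(* Two parts of at most 2^m - 1 vertices, together with x, would make at most 2^(m+1) - 1. *)
have [Nt | Nf] : 2 ^ m <= #|` N true| \/ 2 ^ m <= #|` N false| by lia.
  have rk1 : (r.+1 + k)%N = m by lia.
  case: (IH r.+1 k (N true) rk1) => [|[T [TN cT hT]]|[T [TN cT hT]]]; first by rewrite rk1.
    left; exists T; split=> //; apply: fsubset_trans TN _.
    by apply: fsubset_trans (NS true); apply: fsubsetUr.
  right; exists (x |` T).
  have xT : x \notin T by apply: contra (xN true); apply: (fsubsetP TN).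
  split; last by apply: extend xT _ hT => y /(fsubsetP TN)/eN.
    by apply: fsubset_trans (fsetUS _ TN) (NS true).
  by rewrite cardfsU1 xT cT.
have rk1 : (r + k.+1)%N = m by lia.
case: (IH r k.+1 (N false) rk1) => [|[T [TN cT hT]]|[T [TN cT hT]]]; first by rewrite rk1.
  left; exists (x |` T).
  have xT : x \notin T by apply: contra (xN false); apply: (fsubsetP TN).
  split.
  - by apply: fsubset_trans (fsetUS _ TN) (NS false).
  - by rewrite cardfsU1 xT cT.
  move=> y z yT zT yz; apply/negbT; apply: (extend false T x xT) yT zT yz.
    by move=> u /(fsubsetP TN)/eN.
  by move=> u v uT vT uv; apply/negbTE/hT.
right; exists T; split=> //; apply: fsubset_trans TN _.
by apply: fsubset_trans (NS false); apply: fsubsetUr.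
Qed.

(** The intersection [X] arises from [K'], a member of [B], by deleting edges. In a large clique of
    [K'], Ramsey's theorem for [G] gives either r independent vertices, which is excluded, or a
    clique of [G], hence of [X], with one vertex more than [clique_number X]; this is the [n.+1] in
    the bound. *)
Lemma chi_guarding_edgeless r : chi_guarding (free (edgeless r)).
Proof.
move=> B [_ B_ind] [f [f_mono hf]]; exists (fun n => f (2 ^ (r + n.+1))).
split=> [m n mn | _ [G [K [GF KB ->]]]]; first by apply: f_mono; rewrite leq_exp2l //; lia.
set X := graph_inter G K; pose K' := induced K (vset G).
have XK' : chromatic_number X <= chromatic_number K'.
  have /colorableP[c ck hc] := chromatic_numberP K'.
  apply/chromatic_number_le/colorableP; exists c => [x | x y].
    by rewrite /= fsetIC; apply: ck.
  rewrite adj_inter => /andP[/adj_vset/and3P[xV yV _] xyK].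
  by apply: hc; rewrite adj_induced xyK xV yV.
apply: leq_trans XK' _; apply: leq_trans (hf _ (B_ind _ _ KB)) _; apply: f_mono.
apply: clique_number_le => S SK cS; rewrite leqNgt; apply/negP => /ltnW.
case/(ramsey (adj_sym G)) => [] [T [TS cT hT]].
  apply: GF; exists T; rewrite -cT.
  have VT : vset (induced G T) = T.
    apply/fsetP => x; rewrite inE andb_idl // => /(fsubsetP TS)/(fsubsetP SK).
    by rewrite inE => /andP[].
  have := @isomorphic_edgeless (induced G T); rewrite VT; apply=> x y; rewrite adj_induced.
  apply/negP => /and3P[xy xT yT]; have := hT x y xT yT (adj_neq xy).
  by rewrite xy.
have : #|` T| <= clique_number X.
  apply: clique_number_ge => [|x y xT yT xy].
    by rewrite /= fsetIC; apply: fsubset_trans TS SK.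
  rewrite adj_inter hT //=.
  by have := cS x y (fsubsetP TS x xT) (fsubsetP TS y yT) xy; rewrite adj_induced => /andP[].
by rewrite cT ltnn.
Qed.

Lemma chi_guarding_isomorphic H K :
  isomorphic H K -> chi_guarding (free K) -> chi_guarding (free H).
Proof.
move=> HK gK B Bh Bchi; have [f [f_mono hf]] := gK B Bh Bchi.
exists f; split=> // X [G [L [GH LB XE]]]; apply: hf; exists G, L; split=> //.
exact: free_isomorphic HK GH.
Qed.

Theorem theorem5p1 (H : graph) (H_nonempty : vset H <> fset0) :
  chi_guarding (free H) <->
  (isomorphic H (path_graph 2) \/ isomorphic H (path_graph 3) \/
   exists r : nat, 0 < r /\ isomorphic H (edgeless r)).
Proof.
split=> [guardH | [H2 | [H3 | [r [_ Hr]]]]]; first exact: guarding_isomorphic.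
- exact: chi_guarding_isomorphic H2 chi_guarding_path2.
- exact: chi_guarding_isomorphic H3 chi_guarding_path3.
- exact: chi_guarding_isomorphic Hr (@chi_guarding_edgeless r).
Qed.
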